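(* On a word category $\mathcal W_L$, consider the cospans $X\xrightarrow{q}Q\xleftarrow{u}1$, where $q$ is a pruning and $u$ is the unique point of $Q$ (here $1$ is the empty word, the zero object). With the comparisons described in the context, these cospans form a noetherian form with exact join decomposition. Its universal quotients are the prunings, and its universal embeddings are the occurrences. Its fibre over a word of length $n$ is the chain $\{0,1,\ldots,n\}$ with its usual order, where a cluster $d$ records the deletion of the suffix of length $d$.
   Context: WORD CATEGORIES. For a set $L$, $\mathcal W_L$ has as objects the finite words over $L$, including the empty word. For words $u,v$, \[\mathcal W_L(u,v)=\{f^r_{u,v}: 0\le r\le\min(|u|,|v|),\ \operatorname{pre}_r(u)=\operatorname{suf}_r(v)\},\] where $\operatorname{pre}_r(u)$ and $\operatorname{suf}_r(v)$ are the prefix of $u$ and the suffix of $v$ of length $r$; the identity of $u$ is $f^{|u|}_{u,u}$ and composition is $f^s_{v,w}f^r_{u,v}=f^{\max(0,r+s-|v|)}_{u,w}$. The empty word is a zero object (initial and terminal) and is denoted $1$. A pruning is a morphism $f^{|v|}_{u,v}$ (so $v$ is a prefix of $u$, and the suffix of $u$ of length $|u|-|v|$ is deleted); an occurrence is a morphism $f^{|u|}_{u,v}$ (so $u$ is a suffix of $v$). A point of $Q$ is a morphism $1\to Q$; it is unique. COMPARISONS. A cluster over $X$ is a cospan $X\xrightarrow{q}Q\xleftarrow{u}1$ as in the claim, up to isomorphism fixing $X$. For clusters $[q,u]$ over $X$ and $[r,v]$ over $Y$ ($r:Y\to R$, $v:1\to R$) and a morphism $f:X\to Y$, $[q,u]\le_f[r,v]$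 when there are $h:Q\to R$ and $k:1\to 1$ with $hq=rf$ and $hu=vk$. FORMS. A form $\mathsf F$ over a category $\mathcal C$ is a faithful functor to $\mathcal C$, described by its sets $\mathsf F(X)$ of clusters over objects $X$ (fibres) and its comparison relations $L\le_fN$ ($f:X\to Y$, $L\in\mathsf F(X)$, $N\in\mathsf F(Y)$), with $L\le_{\mathrm{id}}L$, and $L\le_fM$, $M\le_gN$ implying $L\le_{gf}N$; $\mathsf F(X)$ is ordered by $\le_{\mathrm{id}_X}$, a partial order. It is orean when each fibre is a bounded lattice and every $f:X\to Y$ has functorial direct and inverse images $f_*:\mathsf F(X)\to\mathsf F(Y)$, $f^*:\mathsf F(Y)\to\mathsf F(X)$ with $f_*L\le N\iff L\le_fN\iff L\le f^*N$. Put $\operatorname{Ker}f=f^*(\bot)$, $\operatorname{Im}f=f_*(\top)$. A cluster over $X$ is normal if it is the kernel of a morphism with domain $X$ and conormal if it is the image of a morphism with codomain $X$. A universal quotient of a cluster $L$ over $X$ is $q:X\to Q$ with $L\le\operatorname{Ker}q$ through which every $f:X\to Y$ with $L\le\operatorname{Ker}f$ factors uniquely. A universal embedding of a cluster $N$ over $Y$ is $m:A\to Y$ with $\operatorname{Im}m\le N$ through which every $f:X\to Y$ with $\operatorname{Im}f\le N$ factors uniquely. The universal quotients (embeddings) of the form are the morphisms that are a universal quotient (embedding) of some cluster. An orean form is noetherian when: (1) $f^*f_*L=L\vee\operatorname{Ker}f$ and $f_*f^*N=N\wedge\operatorname{Im}f$ for all $f:X\to Y$, $L\in\mathsf F(X)$,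 $N\in\mathsf F(Y)$; (2) every morphism factors as a universal quotient of its kernel followed by a universal embedding of its image; (3) binary joins of normal clusters are normal and binary meets of conormal clusters are conormal. It has exact join decomposition if every cluster $L$ has a largest normal cluster $n(L)\le L$ and a largest conormal cluster $c(L)\le L$, and $L=c(L)\vee n(L)$, $f^*n(N)=n(f^*N)$, $f_*n(\top)=n(\operatorname{Im}f)$ for all $L$, all $f:X\to Y$ and all $N\in\mathsf F(Y)$. *)

(* Defs.v *)
From mathcomp Require Import all_boot zify.
From mathcomp Require Import boolp.

Set Implicit Arguments.
Unset Strict Implicit.
Unset Printing Implicit Defensive.

Record category := Category {
  ob :> Type;
  hom : ob -> ob -> Type;
  idm : forall X, hom X X;
  compm : forall X Y Z, hom Y Z -> hom X Y -> hom X Z;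
  compmA : forall X Y Z T (h : hom Z T) (g : hom Y Z) (f : hom X Y),
    compm h (compm g f) = compm (compm h g) f;
  comp1m : forall X Y (f : hom X Y), compm (idm Y) f = f;
  compm1 : forall X Y (f : hom X Y), compm f (idm X) = f
}.

Arguments hom {c} X Y : rename.
Arguments idm {c} X : rename.
Arguments compm {c X Y Z} g f : rename.

Definition isom (C : category) (X Y : C) (f : hom X Y) : Prop :=
  exists g : hom Y X, compm g f = idm X /\ compm f g = idm Y.

(* [fle f L N] is the comparison written L <=_f N. *)
Record form_data (C : category) := FormData {
  fib :> C -> Type;
  fle : forall X Y : C, hom X Y -> fib X -> fib Y -> Prop
}.

Arguments fle {C f X Y} h L N : rename.

Definition fib_le (C : category) (F : form_data C) (X : C) (L M : F X) : Prop :=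
  fle (idm X) L M.

(* The functor is the projection to C of the category whose objects are pairs
   (X, L) with L in F X and whose morphisms (X, L) -> (Y, N) are the f : X -> Y
   with L <=_f N; faithfulness is built into this description. *)
Record is_form (C : category) (F : form_data C) : Prop := IsForm {
  fle_refl : forall (X : C) (L : F X), fib_le L L;
  fle_trans : forall (X Y Z : C) (f : hom X Y) (g : hom Y Z)
      (L : F X) (M : F Y) (N : F Z),
    fle f L M -> fle g M N -> fle (compm g f) L N;
  fle_anti : forall (X : C) (L M : F X), fib_le L M -> fib_le M L -> L = M
}.

(* The operations are determined by the comparisons, through antisymmetry. *)
Record orean (C : category) (F : form_data C) := Orean {
  orean_form : is_form F;
  fbot : forall X : C, F X;
  ftop : forall X : C, F X;
  fjoin : forall X : C, F X -> F X -> F X;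
  fmeet : forall X : C, F X -> F X -> F X;
  fbotP : forall (X : C) (L : F X), fib_le (fbot X) L;
  ftopP : forall (X : C) (L : F X), fib_le L (ftop X);
  fjoinP : forall (X : C) (L M N : F X),
    fib_le (fjoin L M) N <-> fib_le L N /\ fib_le M N;
  fmeetP : forall (X : C) (L M N : F X),
    fib_le N (fmeet L M) <-> fib_le N L /\ fib_le N M;
  dimg : forall X Y : C, hom X Y -> F X -> F Y;
  iimg : forall X Y : C, hom X Y -> F Y -> F X;
  dimgP : forall (X Y : C) (f : hom X Y) (L : F X) (N : F Y),
    fib_le (dimg f L) N <-> fle f L N;
  iimgP : forall (X Y : C) (f : hom X Y) (L : F X) (N : F Y),
    fle f L N <-> fib_le L (iimg f N);
  dimg_id : forall (X : C) (L : F X), dimg (idm X) L = L;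
  dimg_comp : forall (X Y Z : C) (f : hom X Y) (g : hom Y Z) (L : F X),
    dimg (compm g f) L = dimg g (dimg f L);
  iimg_id : forall (X : C) (L : F X), iimg (idm X) L = L;
  iimg_comp : forall (X Y Z : C) (f : hom X Y) (g : hom Y Z) (N : F Z),
    iimg (compm g f) N = iimg f (iimg g N)
}.

Section Orean.
Variables (C : category) (F : form_data C) (O : orean F).

Definition Ker (X Y : C) (f : hom X Y) : F X := iimg O f (fbot O Y).
Definition Im (X Y : C) (f : hom X Y) : F Y := dimg O f (ftop O X).

Definition normal (X : C) (L : F X) : Prop :=
  exists (Y : C) (f : hom X Y), L = Ker f.
Definition conormal (Y : C) (N : F Y) : Prop :=
  exists (X : C) (f : hom X Y), N = Im f.

Definition universal_quotient_of (X : C) (L : F X) (Q : C) (q : hom X Q) : Prop :=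
  fib_le L (Ker q) /\
  forall (Y : C) (f : hom X Y), fib_le L (Ker f) ->
    exists! g : hom Q Y, f = compm g q.

Definition universal_embedding_of (Y : C) (N : F Y) (A : C) (m : hom A Y) : Prop :=
  fib_le (Im m) N /\
  forall (X : C) (f : hom X Y), fib_le (Im f) N ->
    exists! g : hom X A, f = compm m g.

Definition universal_quotient (X Q : C) (q : hom X Q) : Prop :=
  exists L : F X, universal_quotient_of L q.
Definition universal_embedding (A Y : C) (m : hom A Y) : Prop :=
  exists N : F Y, universal_embedding_of N m.

Record noetherian : Prop := Noetherian {
  iimg_dimg : forall (X Y : C) (f : hom X Y) (L : F X),
    iimg O f (dimg O f L) = fjoin O L (Ker f);
  dimg_iimg : forall (X Y : C) (f : hom X Y) (N : F Y),
    dimg O f (iimg O f N) = fmeet O N (Im f);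
  factorization : forall (X Y : C) (f : hom X Y),
    exists (Q : C) (q : hom X Q) (m : hom Q Y),
      [/\ universal_quotient_of (Ker f) q,
          universal_embedding_of (Im f) m & f = compm m q];
  normal_join : forall (X : C) (L M : F X),
    normal L -> normal M -> normal (fjoin O L M);
  conormal_meet : forall (X : C) (L M : F X),
    conormal L -> conormal M -> conormal (fmeet O L M)
}.

Definition largest_below (P : forall X : C, F X -> Prop) (X : C) (L M : F X) : Prop :=
  [/\ P X M, fib_le M L & forall M' : F X, P X M' -> fib_le M' L -> fib_le M' M].

Definition exact_join_decomposition : Prop :=
  exists n c : forall X : C, F X -> F X,
    [/\ forall (X : C) (L : F X), largest_below normal L (n X L),
        forall (X : C) (L : F X), largest_below conormal L (c X L),
        forall (X : C) (L : F X), L = fjoin O (c X L) (n X L),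
        forall (X Y : C) (f : hom X Y) (N : F Y),
          iimg O f (n Y N) = n X (iimg O f N)
      & forall (X Y : C) (f : hom X Y), dimg O f (n X (ftop O X)) = n Y (Im f)].

End Orean.

Section Cospans.
Variables (C : category) (E : forall X Y : C, hom X Y -> Prop) (P : C).

Record cospan (X : C) := Cospan {
  apex : C;
  leg : hom X apex;
  leg_in : E leg;
  foot : hom P apex
}.

Definition cospan_iso (X : C) (c d : cospan X) : Prop :=
  exists (h : hom (apex c) (apex d)) (k : hom P P),
    [/\ isom h, isom k, compm h (leg c) = leg d
      & compm h (foot c) = compm (foot d) k].

Definition cospan_le (X Y : C) (f : hom X Y) (c : cospan X) (d : cospan Y) : Prop :=
  exists (h : hom (apex c) (apex d)) (k : hom P P),
    compm h (leg c) = compm (leg d) f /\ compm h (foot c) = compm (foot d) k.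

(* Cospans up to isomorphism fixing X, as isomorphism classes. *)
Definition cluster (X : C) : Type :=
  {A : cospan X -> Prop | exists c : cospan X, A = cospan_iso c}.

Definition cluster_of (X : C) (c : cospan X) : cluster X :=
  exist _ (cospan_iso c) (ex_intro _ c erefl).

Definition cluster_le (X Y : C) (f : hom X Y) (L : cluster X) (N : cluster Y) : Prop :=
  exists (c : cospan X) (d : cospan Y),
    [/\ L = cluster_of c, N = cluster_of d & cospan_le f c d].

Definition cluster_form : form_data C := FormData cluster_le.

End Cospans.

Section Words.
Variable L : Type.
Implicit Types u v w x : seq L.

Definition pre (r : nat) (u : seq L) : seq L := take r u.
Definition suf (r : nat) (v : seq L) : seq L := drop (size v - r) v.

(* [WHom r _ _ : whom u v] is the morphism f^r_{u,v}. *)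
Record whom (u v : seq L) := WHom {
  rank : nat;
  rank_le : rank <= minn (size u) (size v);
  rank_eq : pre rank u = suf rank v
}.

Lemma whom_inj u v (f g : whom u v) : rank f = rank g -> f = g.
Proof.
case: f g => [r a b] [s c d] /= e; subst s.
by congr WHom; apply: Prop_irrelevance.
Qed.

Lemma wid_le u : size u <= minn (size u) (size u).
Proof. by rewrite minnn. Qed.

Lemma wid_eq u : pre (size u) u = suf (size u) u.
Proof. by rewrite /pre /suf take_size subnn drop0. Qed.

Definition wid u : whom u u := WHom (wid_le u) (wid_eq u).

(* The maximum with 0 is taken by truncated subtraction. *)
Definition wcomp_rank u v w (g : whom v w) (f : whom u v) : nat :=
  rank f + rank g - size v.

Lemma wcomp_le u v w (g : whom v w) (f : whom u v) :
  wcomp_rank g f <= minn (size u) (size w).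
Proof. by rewrite /wcomp_rank; have := rank_le f; have := rank_le g; lia. Qed.

Lemma wcomp_eq u v w (g : whom v w) (f : whom u v) :
  pre (wcomp_rank g f) u = suf (wcomp_rank g f) w.
Proof.
rewrite /wcomp_rank; case: f g => [r ru er] [s sw es] /=.
rewrite /pre /suf in er es *; move: ru sw; set t := r + s - size v => ru sw.
have [t0|t_gt0] := posnP t; first by rewrite t0 take0 subn0 drop_size.
have -> : size w - t = (s - t) + (size w - s) by lia.
rewrite -drop_drop -es.
have -> : take t u = take t (take r u) by rewrite take_takel //; lia.
by rewrite er take_drop; congr (drop _ (take _ _)); lia.
Qed.

Definition wcomp u v w (g : whom v w) (f : whom u v) : whom u w :=
  WHom (wcomp_le g f) (wcomp_eq g f).

Lemma wcompA u v w x (h : whom w x) (g : whom v w) (f : whom u v) :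
  wcomp h (wcomp g f) = wcomp (wcomp h g) f.
Proof.
apply: whom_inj; rewrite /= /wcomp_rank /= /wcomp_rank.
by have := rank_le f; have := rank_le g; have := rank_le h; lia.
Qed.

Lemma wcomp1m u v (f : whom u v) : wcomp (wid v) f = f.
Proof.
by apply: whom_inj; rewrite /= /wcomp_rank /=; have := rank_le f; lia.
Qed.

Lemma wcompm1 u v (f : whom u v) : wcomp f (wid u) = f.
Proof.
by apply: whom_inj; rewrite /= /wcomp_rank /=; have := rank_le f; lia.
Qed.

Definition word_cat : category := Category wcompA wcomp1m wcompm1.

Definition pruning (u v : word_cat) (f : hom u v) : Prop :=
  rank f = size (v : seq L).
Definition occurrence (u v : word_cat) (f : hom u v) : Prop :=
  rank f = size (u : seq L).

Lemma wzero_le u v : 0 <= minn (size u) (size v).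
Proof. by []. Qed.

Lemma wzero_eq u v : pre 0 u = suf 0 v.
Proof. by rewrite /pre /suf take0 subn0 drop_size. Qed.

Definition wzero u v : whom u v := WHom (wzero_le u v) (wzero_eq u v).

Definition wone : word_cat := [::].

Lemma wone_initial v (f : whom [::] v) : f = wzero [::] v.
Proof. by apply: whom_inj; have := rank_le f; rewrite /=; lia. Qed.

Lemma wone_terminal u (f : whom u [::]) : f = wzero u [::].
Proof. by apply: whom_inj; have := rank_le f; rewrite /=; lia. Qed.

Definition word_form : form_data word_cat := cluster_form pruning wone.

Definition delete (u : seq L) (d : nat) : seq L := take (size u - d) u.

Lemma delete_le u d : size (delete u d) <= minn (size u) (size (delete u d)).
Proof. by rewrite size_take_min; lia. Qed.

Lemma delete_eq u d :
  pre (size (delete u d)) u = suf (size (delete u d)) (delete u d).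
Proof.
rewrite /pre /suf subnn drop0 /delete size_take_min.
by have /minn_idPl -> : size u - d <= size u by lia.
Qed.

Definition delete_hom u d : hom (u : word_cat) (delete u d : word_cat) :=
  WHom (delete_le u d) (delete_eq u d).

Lemma delete_pruning u d : pruning (delete_hom u d).
Proof. by []. Qed.

Definition delete_cluster (u : word_cat) (d : nat) : word_form u :=
  cluster_of (Cospan (delete_pruning u d)
                     (wzero [::] (delete u d) : hom wone (delete u d : word_cat))).

End Words.

Arguments delete_cluster {L} u d.

(* Main.v *)
Require Import Defs.
From mathcomp Require Import all_boot.
From mathcomp Require Import zify.
From mathcomp Require Import boolp.

(** A cluster over a word of length [n] is determined by the number [d <= n] of
    deleted letters.  In these terms, for [f = f^r_{u,v}] with [|u| = n], the
    comparison [d <=_f e] reads [d + r <= n + e], so that [f_* d = max(0, d + r - n)] and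
    [f^* e = min(n, n + e - r)]; in particular [Ker f = n - r] and [Im f = r].
    Hence every cluster is both normal and conormal, and the axioms become linear
    arithmetic. *)

Set Implicit Arguments.
Unset Strict Implicit.
Unset Printing Implicit Defensive.

Section WordForm.
Variable L : Type.
Local Notation W := (word_cat L).
Local Notation F := (word_form L).
Local Notation sz u := (size (u : seq L)).
Implicit Types u v w : W.

(** * Ranks, prunings and occurrences *)

Lemma rank_leq u v (f : hom u v) : (rank f <= sz u) && (rank f <= sz v).
Proof. by have := rank_le f; rewrite leq_min. Qed.

Lemma rank_compm u v w (g : hom v w) (f : hom u v) :
  rank (compm g f) = rank f + rank g - sz v.
Proof. by []. Qed.

Lemma rank_idm u : rank (idm u) = sz u.
Proof. by []. Qed.

Lemma pruning_codom u v (q : hom u v) : pruning q -> v = take (sz v) u :> seq L.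
Proof.
by move=> hq; have := rank_eq q; rewrite hq /pre /suf subnn drop0.
Qed.

Lemma occurrence_dom u v (m : hom u v) :
  occurrence m -> u = drop (sz v - sz u) v :> seq L.
Proof.
by move=> hm; have := rank_eq m; rewrite hm /pre /suf take_size.
Qed.

(** The factor keeps the rank of [f]: as [v] is a prefix of [u], any prefix of [u] no longer than
    [v] is a prefix of [v]. Composing with a pruning leaves the rank unchanged. *)
Lemma pruning_factor u v w (q : hom u v) (f : hom u w) :
  pruning q -> rank f <= sz v -> exists g : hom v w, f = compm g q.
Proof.
move=> hq hf; have ev := pruning_codom hq.
have le_g : rank f <= minn (sz v) (sz w).
  by rewrite leq_min hf; case/andP: (rank_leq f).
have eq_g : pre (rank f) (v : seq L) = suf (rank f) (w : seq L).
  by rewrite -(rank_eq f) ev /pre take_takel.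
exists (WHom le_g eq_g); apply: whom_inj.
by rewrite rank_compm /= hq; lia.
Qed.

Lemma pruning_epi u v w (q : hom u v) (g h : hom v w) :
  pruning q -> compm g q = compm h q -> g = h.
Proof.
move=> hq e; apply: whom_inj; have := congr1 (@rank _ _ _) e.
by rewrite !rank_compm hq; lia.
Qed.

(** Dual argument: a suffix of [v] no longer than [u] is a suffix of [u], so again the rank of [f]
    serves for the factor. *)
Lemma occurrence_factor u v w (m : hom u v) (f : hom w v) :
  occurrence m -> rank f <= sz u -> exists g : hom w u, f = compm m g.
Proof.
move=> hm hf; have eu := occurrence_dom hm.
have le_uv : sz u <= sz v by have := rank_leq m; rewrite hm; lia.
have le_g : rank f <= minn (sz w) (sz u).
  by rewrite leq_min hf; case/andP: (rank_leq f) => ->.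
have eq_g : pre (rank f) (w : seq L) = suf (rank f) (u : seq L).
  rewrite (rank_eq f) /suf [in RHS]eu drop_drop -eu; congr (drop _ _); lia.
exists (WHom le_g eq_g); apply: whom_inj.
by rewrite rank_compm /= hm; lia.
Qed.

Lemma occurrence_mono u v w (m : hom u v) (g h : hom w u) :
  occurrence m -> compm m g = compm m h -> g = h.
Proof.
move=> hm e; apply: whom_inj; have := congr1 (@rank _ _ _) e.
by rewrite !rank_compm hm; lia.
Qed.

(** Provides an embedding with prescribed image, as [delete_hom] provides a quotient with prescribed
    kernel. *)
Lemma suffix_occurrence v n : n <= sz v ->
  exists (u : W) (m : hom u v), occurrence m /\ sz u = n.
Proof.
move=> hn; pose u : seq L := drop (size v - n) v.
have su : size u = n by rewrite size_drop; lia.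
have le_m : n <= minn (size u) (size v) by rewrite su leq_min leqnn.
have eq_m : pre n u = suf n v by rewrite /pre -[n in take n]su take_size.
by exists u, (WHom le_m eq_m).
Qed.

Lemma size_delete (u : seq L) d : size (delete u d) = size u - d.
Proof. by rewrite size_take_min; lia. Qed.

(** * Clusters as numbers of deleted letters *)

Local Notation Cosp := (@cospan W (@pruning L) (wone L)).

Lemma rank_leg u (c : Cosp u) : rank (leg c) = sz (apex c).
Proof. exact: (leg_in c). Qed.

Lemma apex_le u (c : Cosp u) : sz (apex c) <= sz u.
Proof. by have := rank_leq (leg c); rewrite rank_leg; lia. Qed.

Lemma cospan_isoE u (c d : Cosp u) :
  cospan_iso c d <-> sz (apex c) = sz (apex d).
Proof.
split=> [[h [k [[h' [e1 e2]] _ _ _]]] |].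
  have := congr1 (@rank _ _ _) e1; have := congr1 (@rank _ _ _) e2.
  rewrite !rank_compm !rank_idm; have := rank_leq h; have := rank_leq h'; lia.
case: c d => [Q q hq a] [R r hr b] /= e.
(* Both apices are prefixes of [u], so equal lengths make them the same word; after transport the
   identity is the required isomorphism. *)
have eQR : Q = R by rewrite (pruning_codom hq) (pruning_codom hr) e.
case: R / eQR r hr b {e} => r hr b; exists (idm Q), (idm (wone L)); split.
- by exists (idm Q); rewrite comp1m.
- by exists (idm (wone L)); rewrite comp1m.
- by apply: whom_inj; rewrite comp1m hq hr.
- by rewrite comp1m compm1 [a]wone_initial [b]wone_initial.
Qed.

(** A comparison is a factorization of [compm (leg d) f] through the pruning [leg c], possible
    exactly when its rank is at most the size of the apex of [c]. The condition on feet is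
    automatic, the empty word being initial. *)
Lemma cospan_leE u v (f : hom u v) (c : Cosp u) (d : Cosp v) :
  cospan_le f c d <-> rank f + sz (apex d) - sz v <= sz (apex c).
Proof.
split=> [[h [k [e _]]] | le_cd].
  have := congr1 (@rank _ _ _) e; rewrite !rank_compm !rank_leg.
  by have := rank_leq h; lia.
have [|h eh] := @pruning_factor _ _ _ (leg c) (compm (leg d) f) (leg_in c).
  by rewrite rank_compm rank_leg.
exists h, (idm (wone L)); split=> //.
by rewrite [LHS]wone_initial [RHS]wone_initial.
Qed.

(** The representative is chosen with [cid]; its apex size depends only on the class, by
    [cospan_isoE]. *)
Definition deleted u (A : F u) : nat := sz u - sz (apex (projT1 (cid (proj2_sig A)))).

Lemma deleted_cluster_of u (c : Cosp u) :
  deleted (cluster_of c : F u) = sz u - sz (apex c).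
Proof.
rewrite /deleted; case: cid => d /= e; congr (_ - _).
by apply/esym/cospan_isoE; rewrite e; apply/cospan_isoE.
Qed.

Lemma cluster_ofP u (A : F u) : exists c : Cosp u, A = cluster_of c.
Proof. by case: A => A [c e]; exists c; apply: eq_exist. Qed.

Lemma deleted_le u (A : F u) : deleted A <= sz u.
Proof. exact: leq_subr. Qed.

(** Reduces every equation between clusters to one between numbers: no apex is longer than [u], so
    the truncated subtraction loses nothing, and the apex size determines the isomorphism class. *)
Lemma deleted_inj u : injective (@deleted u).
Proof.
move=> A B; have [c ->] := cluster_ofP A; have [d ->] := cluster_ofP B.
rewrite !deleted_cluster_of => e; apply: eq_exist; apply/funext => x.
have {}e : sz (apex c) = sz (apex d).
  by have := apex_le c; have := apex_le d; lia.
by apply/propext; rewrite !cospan_isoE e.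
Qed.

Lemma deleted_delete u n : n <= sz u -> deleted (delete_cluster u n) = n.
Proof.
by move=> le_n; rewrite deleted_cluster_of /= size_delete; lia.
Qed.

Lemma cluster_leE u v (f : hom u v) (A : F u) (B : F v) :
  fle f A B <-> deleted A + rank f <= sz u + deleted B.
Proof.
split=> [[c [d [-> -> /cospan_leE]]] | ].
  rewrite !deleted_cluster_of; have := apex_le c; have := apex_le d; lia.
have [c ->] := cluster_ofP A; have [d ->] := cluster_ofP B.
rewrite !deleted_cluster_of => le_cd; exists c, d; split=> //.
by apply/cospan_leE; have := apex_le c; have := apex_le d; lia.
Qed.

Lemma fib_leE u (A B : F u) : fib_le A B <-> deleted A <= deleted B.
Proof. by rewrite /fib_le cluster_leE rank_idm addnC leq_add2l. Qed.

Lemma word_is_form : is_form F.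
Proof.
split=> [u A | u v w f g A B C | u A B].
- exact/fib_leE.
- move=> /cluster_leE AB /cluster_leE BC; apply/cluster_leE.
  by rewrite rank_compm; have := deleted_le A; lia.
- move=> /fib_leE AB /fib_leE BA; apply: deleted_inj; lia.
Qed.

(** * Images and lattice operations *)

Definition wdimg u v (f : hom u v) (A : F u) : F v :=
  delete_cluster v (deleted A + rank f - sz u).
(** The cap by [sz u] takes effect when [deleted B] exceeds [rank f]. *)
Definition wiimg u v (f : hom u v) (B : F v) : F u :=
  delete_cluster u (minn (sz u) (sz u + deleted B - rank f)).
Definition wjoin u (A B : F u) : F u :=
  delete_cluster u (maxn (deleted A) (deleted B)).
Definition wmeet u (A B : F u) : F u :=
  delete_cluster u (minn (deleted A) (deleted B)).

Lemma deleted_bot u : deleted (delete_cluster u 0) = 0.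
Proof. exact: deleted_delete. Qed.

Lemma deleted_top u : deleted (delete_cluster u (sz u)) = sz u.
Proof. exact: deleted_delete. Qed.

Lemma deleted_dimg u v (f : hom u v) (A : F u) :
  deleted (wdimg f A) = deleted A + rank f - sz u.
Proof.
by apply: deleted_delete; have := deleted_le A; have := rank_leq f; lia.
Qed.

Lemma deleted_iimg u v (f : hom u v) (B : F v) :
  deleted (wiimg f B) = minn (sz u) (sz u + deleted B - rank f).
Proof. by apply: deleted_delete; rewrite geq_minl. Qed.

Lemma deleted_join u (A B : F u) :
  deleted (wjoin A B) = maxn (deleted A) (deleted B).
Proof. by apply: deleted_delete; rewrite geq_max !deleted_le. Qed.

Lemma deleted_meet u (A B : F u) :
  deleted (wmeet A B) = minn (deleted A) (deleted B).
Proof. by apply: deleted_delete; rewrite geq_min deleted_le. Qed.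

Definition word_orean : orean F.
Proof.
apply: (@Orean _ F word_is_form (fun u => delete_cluster u 0)
  (fun u => delete_cluster u (sz u)) wjoin wmeet _ _ _ _ wdimg wiimg).
- by move=> u A; rewrite fib_leE deleted_bot.
- by move=> u A; rewrite fib_leE deleted_top deleted_le.
- by move=> u A B C; rewrite !fib_leE deleted_join geq_max; split=> /andP.
- by move=> u A B C; rewrite !fib_leE deleted_meet leq_min; split=> /andP.
- by move=> u v f A B; rewrite fib_leE cluster_leE deleted_dimg; lia.
- move=> u v f A B; rewrite fib_leE cluster_leE deleted_iimg.
  by have := deleted_le A; have := rank_leq f; lia.
- by move=> u A; apply: deleted_inj; rewrite deleted_dimg rank_idm addnK.
(* Truncating at the intermediate word does no harm: [deleted A <= sz u] and [rank g <= sz v] make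
   both sides vanish together. *)
- move=> u v w f g A; apply: deleted_inj; rewrite !deleted_dimg rank_compm.
  by have := deleted_le A; have := rank_leq g; lia.
- move=> u A; apply: deleted_inj; rewrite deleted_iimg rank_idm.
  by have := deleted_le A; lia.
- move=> u v w f g A; apply: deleted_inj; rewrite !deleted_iimg rank_compm.
  by have := deleted_le A; have := rank_leq f; have := rank_leq g; lia.
(* Kept transparent so that rewriting sees [wdimg], [wiimg], [wjoin] and [wmeet] behind the
   fields. *)
Defined.

Local Notation O := word_orean.

(** * Kernels, images and the axioms *)

Lemma deleted_Ker u v (f : hom u v) : deleted (Ker O f) = sz u - rank f.
Proof. by rewrite deleted_iimg deleted_bot; lia. Qed.

Lemma deleted_Im u v (f : hom u v) : deleted (Im O f) = rank f.
Proof. by rewrite deleted_dimg deleted_top; lia. Qed.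

(** The condition [fib_le A (Ker O f)] amounts to [rank f <= sz v], which is the hypothesis of
    [pruning_factor]. *)
Lemma pruning_universal u v (q : hom u v) (A : F u) :
  pruning q -> deleted A = sz u - sz v -> universal_quotient_of O A q.
Proof.
move=> hq dA; have := rank_leq q; rewrite hq => le_vu; split.
  by rewrite fib_leE deleted_Ker hq dA.
move=> w f; rewrite fib_leE deleted_Ker dA => le_f.
have [|g eg] := pruning_factor (f := f) hq; first by have := rank_leq f; lia.
by exists g; split=> // h eh; apply: (pruning_epi hq); rewrite -eg -eh.
Qed.

Lemma occurrence_universal u v (m : hom u v) (B : F v) :
  occurrence m -> deleted B = sz u -> universal_embedding_of O B m.
Proof.
move=> hm dB; split; first by rewrite fib_leE deleted_Im hm dB.
move=> w f; rewrite fib_leE deleted_Im dB => le_f.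
have [g eg] := occurrence_factor hm le_f.
by exists g; split=> // h eh; apply: (occurrence_mono hm); rewrite -eg -eh.
Qed.

Lemma all_normal u (A : F u) : normal O A.
Proof.
exists (delete u (deleted A)), (delete_hom u (deleted A)).
apply: deleted_inj; rewrite deleted_Ker delete_pruning size_delete.
by have := deleted_le A; lia.
Qed.

(** The suffix that a cluster deletes is itself a word, and its occurrence in [u] has that cluster
    as image. *)
Lemma all_conormal u (A : F u) : conormal O A.
Proof.
have [v [m [hm sv]]] := suffix_occurrence (deleted_le A).
by exists v, m; apply: deleted_inj; rewrite deleted_Im hm.
Qed.

Lemma word_noetherian : noetherian O.
Proof.
split=> [u v f A | u v f B | u v f | u A B _ _ | u A B _ _].
- apply: deleted_inj.
  rewrite deleted_iimg deleted_dimg deleted_join deleted_Ker.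
  by have := deleted_le A; have := rank_leq f; lia.
- apply: deleted_inj.
  rewrite deleted_dimg deleted_iimg deleted_meet deleted_Im.
  by have := rank_leq f; lia.
(* The middle word is the prefix of [u] of length [rank f], which is also a suffix of [v]. The
   pruning preserves ranks, so [m] has full rank on it and is an occurrence. *)
- pose q := delete_hom u (sz u - rank f).
  have hq : pruning q by [].
  have szQ : size (delete u (sz u - rank f)) = rank f.
    by rewrite size_delete; have := rank_leq f; lia.
  have [|m fE] := pruning_factor (f := f) hq; first by rewrite szQ.
  have hm : occurrence m.
    have := congr1 (@rank _ _ _) fE; rewrite rank_compm hq /occurrence szQ; lia.
  exists (delete u (sz u - rank f)), q, m; split=> //.
  + by apply: pruning_universal; rewrite // deleted_Ker szQ.
  + by apply: occurrence_universal; rewrite // deleted_Im szQ.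
- exact: all_normal.
- exact: all_conormal.
Qed.

Lemma word_exact_join_decomposition : exact_join_decomposition O.
Proof.
(* Every cluster is its own largest normal and largest conormal part, so what remains is idempotence
   of the join. *)
exists (fun _ => id), (fun _ => id); split=> // u A.
- by split=> //; [apply: all_normal | apply/fib_leE].
- by split=> //; [apply: all_conormal | apply/fib_leE].
- by apply: deleted_inj; rewrite deleted_join maxnn.
Qed.

(** * Characterization of universal quotients and embeddings *)

Lemma universal_quotientE u v (q : hom u v) :
  universal_quotient O q <-> pruning q.
Proof.
split=> [[A [le_A uq]] | hq]; last first.
  exists (Ker O q); apply: pruning_universal => //.
  by rewrite deleted_Ker hq.
(* The pruning deleting [deleted A] letters is another universal quotient of [A]; [q] is compared
   with it. *)
have szQ : size (delete u (deleted A)) = sz u - deleted A by rewrite size_delete.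
have hp : pruning (delete_hom u (deleted A)) by [].
have dA : deleted A = sz u - size (delete u (deleted A)).
  by rewrite szQ; have := deleted_le A; lia.
have [le_Ap up] := pruning_universal hp dA.
have [g [gE _]] := uq _ _ le_Ap; have [h [hE _]] := up _ _ le_A.
(* Both [idm v] and [compm h g] factor [q] through itself, so uniqueness identifies them. *)
have [i [_ uniq_i]] := uq _ _ le_A.
have hgE : compm h g = idm v.
  rewrite -(uniq_i (idm v)) ?comp1m //.
  by apply/esym/uniq_i; rewrite -compmA -gE -hE.
(* The identity [hgE] forces [rank h = sz v], and [hE] gives [rank q = rank h]. *)
have := congr1 (@rank _ _ _) hE; have := congr1 (@rank _ _ _) hgE.
rewrite !rank_compm rank_idm hp /pruning.
by have := rank_leq g; have := rank_leq q; lia.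
Qed.

Lemma universal_embeddingE u v (m : hom u v) :
  universal_embedding O m <-> occurrence m.
Proof.
split=> [[B [le_B um]] | hm]; last first.
  by exists (Im O m); apply: occurrence_universal; rewrite // deleted_Im.
(* Dually, [m] is compared with the occurrence of the suffix of length [deleted B]. *)
have [w [p [hp sw]]] := suffix_occurrence (deleted_le B).
have [le_Bp up] := occurrence_universal hp (esym sw).
have [g [gE _]] := um _ _ le_Bp; have [h [hE _]] := up _ _ le_B.
have [i [_ uniq_i]] := um _ _ le_B.
have ghE : compm g h = idm u.
  rewrite -(uniq_i (idm u)) ?compm1 //.
  by apply/esym/uniq_i; rewrite compmA -gE -hE.
have := congr1 (@rank _ _ _) hE; have := congr1 (@rank _ _ _) ghE.
rewrite !rank_compm rank_idm hp /occurrence.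
by have := rank_leq g; have := rank_leq m; lia.
Qed.

(** * The fibres as chains *)

Lemma delete_cluster_bij u :
  bijective (fun d : 'I_(sz u).+1 => delete_cluster u d).
Proof.
(* The default value of [inord] is never reached, because [deleted A <= sz u]. *)
exists (fun A : F u => inord (deleted A)) => [d | A].
  by rewrite deleted_delete ?inord_val // -ltnS.
apply: deleted_inj; rewrite inordK ?deleted_delete ?deleted_le //.
by rewrite ltnS deleted_le.
Qed.

Lemma delete_cluster_le u (d e : 'I_(sz u).+1) :
  fib_le (delete_cluster u d) (delete_cluster u e) <-> d <= e.
Proof. by rewrite fib_leE !deleted_delete // -ltnS. Qed.

End WordForm.

Theorem theorem3p16 (L : Type) :
  exists O : orean (word_form L),
    noetherian O /\
    exact_join_decomposition O /\
    (forall (u v : word_cat L) (f : hom u v), universal_quotient O f <-> pruning f) /\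
    (forall (u v : word_cat L) (f : hom u v), universal_embedding O f <-> occurrence f) /\
    (forall (n : nat) (u : word_cat L), size (u : seq L) = n ->
       bijective (fun d : 'I_n.+1 => delete_cluster u d) /\
       forall d e : 'I_n.+1,
         fib_le (delete_cluster u d) (delete_cluster u e) <-> d <= e).
Proof.
exists (word_orean L); split; first exact: word_noetherian.
split; first exact: word_exact_join_decomposition.
split; first exact: universal_quotientE.
split; first exact: universal_embeddingE.
move=> _ u <-; split; first exact: delete_cluster_bij.
exact: delete_cluster_le.
Qed.
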